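(* Let $A\in\mathbb{H}_d$ have spectral decomposition $A=U\Lambda_\alpha U^*$, where $U$ is unitary and $\alpha\in\mathbb{R}^d_{\geq}$ is the vector of eigenvalues of $A$, and let $F$ be a vector field that is $C^1$ point-symmetric at $\alpha$. Then $\mathcal{L}_F$ is Fréchet differentiable at $A$, and its Fréchet derivative $\mathcal{L}_F'$ at $A$ is given as follows: for every $E\in\mathbb{H}_d$, setting $\hat E=U^*EU$ and letting $\hat e\in\mathbb{R}^d$ be the vector of diagonal entries of $\hat E$, $$\mathcal{L}_F'(E)=U\Big([F,\alpha]\circ \hat E+\operatorname{diag}\big(((F^{ext})'|_{\alpha})^o\, \hat{e}\big)\Big)U^*.$$
   Context: $\mathbb{H}_d$ is the real vector space of Hermitian $d\times d$ complex matrices. $\mathbb{R}^d_{\geq}$ is the set of $x\in\mathbb{R}^d$ with $x_1\geq x_2\geq\dots\geq x_d$. For a vector $v$, $\Lambda_v=\operatorname{diag}(v)$ is the diagonal matrix with diagonal $v$. A vector field $F$ is block-constant at $x$ if $F_m(x)=F_n(x)$ whenever $x_m=x_n$. For $A\in\mathbb{H}_d$ with spectral decomposition $A=U_A\Lambda_\alpha U_A^*$ ($U_A$ unitary, $\alpha\in\mathbb{R}^d_{\geq}$ the non-increasingly ordered eigenvalues with multiplicity) and $F$ block-constant at $\alpha$, define $\mathcal{L}_F(A)=U_A\Lambda_{F(\alpha)}U_A^*$ (independent of the choice of $U_A$). Extension: for $F:\mathbb{R}^d_{\geq}\to\mathbb{R}^d$ and $x\in\mathbb{R}^d$, put $F^{ext}(x)=\Sigma^*F(\Sigma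 x)$, where $\Sigma$ is any permutation matrix with $\Sigma x\in\mathbb{R}^d_{\geq}$; this is well defined at $x$ (independent of $\Sigma$) when $F$ is block-constant at $\Sigma x$. $F^{ext}$ is point-symmetric at $x$ if $F^{ext}(\Pi x)=\Pi F^{ext}(x)$ for all permutation matrices $\Pi$. $F:\mathbb{R}^d_{\geq}\to\mathbb{R}^d$ is called $C^1$ point-symmetric at $\alpha\in\mathbb{R}^d_{\geq}$ if $F^{ext}$ is point-symmetric and $C^1$ at $\alpha$; here ''$C^1$ at $\alpha$'' means that $F^{ext}$ is well defined (so $F$ is block-constant at all points of $\mathbb{R}^d_\geq$ near $\alpha$) and continuously differentiable in a neighbourhood of $\alpha$ in $\mathbb{R}^d$. $(F^{ext})'|_\alpha$ denotes the $d\times d$ Jacobian matrix of $F^{ext}$ at $\alpha$. $[F,\alpha]$ is the $d\times d$ matrix with entries $$[F,\alpha](m,n)=\begin{cases}\frac{F_m(\alpha)-F_n(\alpha)}{\alpha_m-\alpha_n}&\alpha_m\neq\alpha_n\\ \partial_mF_m(\alpha)-\partial_mF_n(\alpha)&\alpha_m=\alpha_n,\ m\neq n\\ \partial_mF_m(\alpha)&m=n,\end{cases}$$ where the partial derivatives are those of $F^{ext}$ at $\alpha$. $\circ$ is the Hadamard (entrywise) product. For a square matrix $M$, $M^o=M-M\circ I$, i.e. $M$ with its diagonal replaced by $0$. A function $\mathcal{F}$ defined near $A$ in $\mathbb{H}_d$ with values in $\mathbb{H}_d$ is Fréchet differentiable at $A$ if there is a real-linear operator $\mathcal{F}':\mathbb{H}_d\to\mathbb{H}_d$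 with $\mathcal{F}(A+E)=\mathcal{F}(A)+\mathcal{F}'(E)+o(\|E\|)$ as $E\to0$ in $\mathbb{H}_d$. *)

(* Defs.v *)
From HB Require Import structures.
From mathcomp Require Import all_boot all_order all_algebra fingroup perm.
From mathcomp Require Import all_classical all_reals all_analysis.
From mathcomp Require Import complex.

Set Implicit Arguments.
Unset Strict Implicit.
Unset Printing Implicit Defensive.

Import Order.TTheory GRing.Theory Num.Theory.
Import numFieldNormedType.Exports.

Local Open Scope ring_scope.
Local Open Scope classical_set_scope.
Local Open Scope sesquilinear_scope.
Local Open Scope complex_scope.

Record hermmx (R : realType) (d : nat) := HermMx {
  hermval :> 'M[R[i]]_d;
  hermvalP : hermval \is hermsymmx }.

Lemma hermsymP (R : realType) (d : nat) (A : 'M[R[i]]_d) :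
  reflect (A^t* = A) (A \is hermsymmx).
Proof.
apply: (iffP (is_hermitianmxP _ _ _)); rewrite expr0 scale1r => h; exact/esym.
Qed.

Section HermitianSpace.
Context {R : realType} {d : nat}.
Local Notation H := (hermmx R d).

HB.instance Definition _ := [isSub of H for @hermval R d].
HB.instance Definition _ := [Choice of H by <:].

Fact hermsymmx_zmod_closed :
  zmod_closed (hermsymmx : {pred 'M[R[i]]_d}).
Proof.
split=> [|A B /hermsymP hA /hermsymP hB]; apply/hermsymP.
  by rewrite trmx0 map_mx0.
by rewrite linearB /= map_mxB hA hB.
Qed.
HB.instance Definition _ := GRing.isZmodClosed.Build _
  (hermsymmx : {pred 'M[R[i]]_d}) hermsymmx_zmod_closed.
HB.instance Definition _ := [SubChoice_isSubZmodule of H by <:].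

Fact herm_scale_subproof (k : R) (A : H) :
  (k%:C *: (A : 'M[R[i]]_d)) \is hermsymmx.
Proof.
apply/hermsymP; rewrite linearZ /= map_mxZ /= (hermsymP _ (hermvalP A)).
by congr (_ *: _); apply/CrealP; rewrite complex_real.
Qed.
Definition herm_scale k A : H := HermMx (herm_scale_subproof k A).

Fact herm_scaleA a b (A : H) :
  herm_scale a (herm_scale b A) = herm_scale (a * b) A.
Proof. by apply: val_inj; rewrite /= scalerA rmorphM. Qed.
Fact herm_scale1 : left_id 1 herm_scale.
Proof. by move=> A; apply: val_inj; rewrite /= rmorph1 scale1r. Qed.
Fact herm_scaleDr : right_distributive herm_scale +%R.
Proof. by move=> a A B; apply: val_inj; rewrite /= scalerDr. Qed.
Fact herm_scaleDl A : {morph herm_scale^~ A : a b / a + b}.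
Proof. by move=> a b; apply: val_inj; rewrite /= rmorphD /= scalerDl. Qed.
HB.instance Definition _ := GRing.Zmodule_isLmodule.Build R H
  herm_scaleA herm_scale1 herm_scaleDr herm_scaleDl.

(* The library norm of a complex matrix (largest modulus of an entry) is an
   R[i]-valued nonnegative real; which norm is used is irrelevant to Frechet
   differentiability, as the space is finite dimensional. *)
Definition herm_norm (A : H) : R := complex.Re `|(A : 'M[R[i]]_d)|.

Fact herm_normE (A : H) : (herm_norm A)%:C = `|(A : 'M[R[i]]_d)|.
Proof. by rewrite /herm_norm RRe_real// normr_real. Qed.
Fact herm_normD (A B : H) : herm_norm (A + B) <= herm_norm A + herm_norm B.
Proof. by rewrite -lecR rmorphD /= !herm_normE ler_normD. Qed.
Fact herm_normZ (k : R) (A : H) :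
  herm_norm (k *: A) = `|k| * herm_norm A.
Proof.
apply: complexI; rewrite rmorphM /= !herm_normE /= normrZ.
by rewrite normc_def /= expr0n addr0 sqrtr_sqr.
Qed.
Fact herm_norm0_eq0 (A : H) : herm_norm A = 0 -> A = 0.
Proof.
move=> A0; apply: val_inj; apply/eqP; rewrite -normr_eq0 /=.
by rewrite -herm_normE A0.
Qed.
HB.instance Definition _ := Lmodule_isNormed.Build R H
  herm_normD herm_normZ herm_norm0_eq0.

Definition herm_diag_subproof (a : 'rV[R]_d) :
  diag_mx (map_mx (real_complex R) a) \is hermsymmx.
Proof.
apply/hermsymP/matrixP=> i j; rewrite !mxE rmorphMn /= eq_sym.
case: eqP => [->|_]; last by rewrite !mulr0n.
by rewrite !mulr1n; apply/CrealP; rewrite complex_real.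
Qed.
Definition herm_diag a : H := HermMx (herm_diag_subproof a).

Fact herm_conj_subproof (U : 'M[R[i]]_d) (A : H) :
  U *m A *m U^t* \is hermsymmx.
Proof.
apply/hermsymP; rewrite !trmx_mul !map_mxM /= trmxCK.
by rewrite (hermsymP _ (hermvalP A)) mulmxA.
Qed.
Definition herm_conj U A : H := HermMx (herm_conj_subproof U A).

End HermitianSpace.

Definition hadamard (K : pzRingType) (m n : nat) (A B : 'M[K]_(m, n)) :=
  map2_mx *%R A B.

Definition offdiag (K : pzRingType) (n : nat) (M : 'M[K]_n) : 'M[K]_n :=
  M - hadamard M 1%:M.

Section VectorFields.
Context {R : realType} {d : nat}.
Implicit Types (F : 'rV[R]_d -> 'rV[R]_d) (x a : 'rV[R]_d) (s t : 'S_d).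

Definition nonincr x := forall i j : 'I_d, (i <= j)%N -> x 0 j <= x 0 i.

(* A field on the chamber of nonincreasing vectors is represented by a total
   function; the definitions below only use its values on that chamber. *)
Definition block_constant F x :=
  forall m n : 'I_d, x 0 m = x 0 n -> F x 0 m = F x 0 n.

Definition sorts s x := nonincr (col_perm s x).

(* Permutation matrices act on row vectors through col_perm, and the adjoint
   matrix through the inverse permutation. *)
Definition ext_by F s x : 'rV[R]_d := col_perm s^-1%g (F (col_perm s x)).

Definition ext_defined F x :=
  forall s t, sorts s x -> sorts t x -> ext_by F s x = ext_by F t x.

Definition ext F x : 'rV[R]_d := ext_by F (xget 1%g [set s | sorts s x]) x.

Let geR : rel R := fun y z => z <= y.

Let geR_trans : transitive geR.
Proof. by move=> y x z yx zy; exact: le_trans zy yx. Qed.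

Let geR_total : total geR.
Proof. by move=> y z; rewrite /geR le_total. Qed.

Lemma sorts_exists x : exists s, sorts s x.
Proof.
pose xs := [tuple x 0 i | i < d].
have st : size (sort geR xs) == d by rewrite size_sort size_tuple.
have /tuple_permP[s sE] : perm_eq (Tuple st) xs by rewrite perm_sort.
exists s => i j ij; rewrite !mxE.
have nE (k : 'I_d) : x 0 (s k) = nth 0 (sort geR xs) k.
  by rewrite [sort _ _]sE -tnth_nth tnth_mktuple tnth_mktuple.
rewrite !nE.
apply: (@sorted_leq_nth _ geR geR_trans _ 0 _ (sort_sorted geR_total _)) => //.
- by move=> y; exact: lexx.
- by rewrite inE size_sort size_tuple.
- by rewrite inE size_sort size_tuple.
Qed.

Lemma nonincr_unique x s : nonincr x -> sorts s x -> col_perm s x = x.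
Proof.
have so (w : 'rV[R]_d) : nonincr w -> sorted geR [tuple w 0 i | i < d].
  move=> wP; apply/(sortedP 0) => l; rewrite size_tuple => ld.
  have ld' := ltn_trans (ltnSn l) ld.
  have e k (kd : (k < d)%N) :
      nth 0 [tuple w 0 i | i < d] k = w 0 (Ordinal kd).
    by rewrite -[k]/(nat_of_ord (Ordinal kd)) -tnth_nth tnth_mktuple.
  by rewrite !e; apply: wP => /=.
move=> xP sP; apply/rowP => k.
have an : antisymmetric geR by move=> y z /andP[zy yz]; apply/le_anti/andP.
have pe : perm_eq [tuple col_perm s x 0 i | i < d] [tuple x 0 i | i < d].
  apply/tuple_permP; exists s; congr val; apply: eq_from_tnth => j.
  by rewrite !tnth_mktuple !mxE.
have := sorted_eq geR_trans an (so _ sP) (so _ xP) pe.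
move=> /(congr1 (fun r => nth 0 r k)).
by rewrite -!tnth_nth !tnth_mktuple.
Qed.

Lemma ext_definedP F x : ext_defined F x <->
  forall s, sorts s x -> block_constant F (col_perm s x).
Proof.
split=> [h s sx m n xmn | h s t sx tx].
  pose t := (tperm m n * s)%g.
  have xt : col_perm t x = col_perm s x.
    apply/rowP => i; rewrite !mxE permM.
    by move: xmn; rewrite !mxE; case: tpermP => [->|->|//] ->.
  have tx : sorts t x by rewrite /sorts xt.
  have := h s t sx tx; rewrite /ext_by xt => /rowP/(_ (s m)).
  by rewrite !mxE permK /t invMg permM permK tpermV tpermL.
pose u := (t * s^-1)%g.
have tE : col_perm t x = col_perm s x.
  have e : col_perm t x = col_perm u (col_perm s x).
    by apply/rowP => i; rewrite !mxE permM permKV.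
  by rewrite e; apply: nonincr_unique => //; rewrite /sorts -e.
apply/rowP => i; rewrite /ext_by tE !mxE; apply: (h s sx).
by rewrite -{2}tE !mxE !permKV.
Qed.

Definition point_symmetric_at (G : 'rV[R]_d -> 'rV[R]_d) x :=
  forall s, G (col_perm s x) = col_perm s (G x).

Definition C1_point_symmetric F a :=
  point_symmetric_at (ext F) a /\
  \forall x \near a, [/\ ext_defined F x, differentiable (ext F) x
                       & {for x, continuous (fun y => 'J (ext F) y)}].

(* The library's 'J acts on row vectors from the right; hence the transpose:
   entry (n, m) below is the m-th partial derivative of the n-th component. *)
Definition ext_jac F a : 'M[R]_d := ('J (ext F) a)^T.

Definition divdiff F a : 'M[R]_d := \matrix_(m, n)
  if a 0 m != a 0 n then (F a 0 m - F a 0 n) / (a 0 m - a 0 n)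
  else if m != n then ext_jac F a m m - ext_jac F a n m
  else ext_jac F a m m.

End VectorFields.

Section SpectralLift.
Context {R : realType} {d : nat}.
Implicit Types (F : 'rV[R]_d -> 'rV[R]_d) (A : hermmx R d).

Definition spectral_decomp A (U : 'M[R[i]]_d) (a : 'rV[R]_d) :=
  [/\ U \is unitarymx, nonincr a & A = herm_conj U (herm_diag a)].

Definition lift_defined F A :=
  exists U a, spectral_decomp A U a /\ block_constant F a.

(* Depends on the chosen decomposition unless lift_defined F A holds: see
   spectral_liftE. *)
Definition spectral_lift F A : hermmx R d :=
  let Ua := xget (1%:M, 0) [set Ua | spectral_decomp A Ua.1 Ua.2] in
  herm_conj Ua.1 (herm_diag (F Ua.2)).

Lemma spectral_decomp_exists A : exists U a, spectral_decomp A U a.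
Proof.
have Aherm := hermvalP A.
have := hermitian_spectral_diag_real Aherm.
have /hermitian_normalmx/orthomx_spectralP := Aherm.
have := spectral_unitarymx A.
move: (spectralmx _) (spectral_diag _) => P b Pu AE bR.
pose b' : 'rV[R]_d := map_mx (@complex.Re R) b.
have bE : b = map_mx (real_complex R) b'.
  apply/rowP => i; rewrite !mxE RRe_real//.
  by have /mxOverP := bR; exact.
have [s sP] := sorts_exists b'.
pose Q := row_perm s P.
have Qu : Q \is unitarymx.
  rewrite /Q row_permE; apply: mul_unitarymx => //; apply/unitarymxP.
  by rewrite tr_perm_mx map_perm_mx -perm_mxM mulgV perm_mx1.
exists (Q^t*), (col_perm s b'); split => //; first by rewrite trmxC_unitary.
apply: val_inj; rewrite /= AE invmx_unitary// trmxCK.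
apply/matrixP => i j; rewrite bE !mul_mx_diag !mxE.
rewrite (reindex_inj (@perm_inj _ s)) /=; apply: eq_bigr => k _.
by rewrite !mxE.
Qed.

Lemma spectral_liftE F A U a : spectral_decomp A U a -> block_constant F a ->
  spectral_lift F A = herm_conj U (herm_diag (F a)).
Proof.
move=> dUa Fa; rewrite /spectral_lift; case: xgetP => [|noUa]; last first.
  by have /= := noUa (U, a).
move=> [V b] _ /= [Vu bP AV]; case: dUa => Uu aP AU.
have Vi : V^t* *m V = 1%:M.
  by rewrite -invmx_unitary ?mulVmx ?unitarymx_unit.
have Ui : U^t* *m U = 1%:M.
  by rewrite -invmx_unitary ?mulVmx ?unitarymx_unit.
have [W WE0] : exists W, W = V^t* *m U by eexists.
have Wu : W \is unitarymx by rewrite WE0 mul_unitarymx ?trmxC_unitary.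
have WE : W *m herm_diag a = herm_diag b *m W.
  have := congr1 (fun B : hermmx R d => V^t* *m B *m U) (etrans (esym AU) AV).
  by rewrite /= !mulmxA Vi mul1mx -!mulmxA Ui mulmx1 WE0 !mulmxA.
have Wab i j : W i j != 0 -> a 0 j = b 0 i.
  move=> Wij; have := congr1 (fun M : 'M[R[i]]_d => M i j) WE.
  rewrite /= mul_mx_diag mul_diag_mx !mxE mulrC => /(mulIf Wij).
  by apply: complexI.
have [s sW] : exists s : 'S_d, forall i, W i (s i) != 0.
  apply: contrapT => noS.
  have /unitarymx_unit := Wu; rewrite unitmxE unitfE => /eqP; apply.
  rewrite /determinant big1// => s _.
  have [i Wi] : exists i, W i (s i) = 0.
    apply: contrapT => noI; apply: noS; exists s => i.
    by apply/eqP => Wi; apply: noI; exists i.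
  by rewrite (bigD1 i)//= Wi mul0r mulr0.
have ab : col_perm s a = b by apply/rowP => i; rewrite mxE; exact: Wab.
have {}ab : a = b.
  by rewrite -ab [RHS]nonincr_unique// /sorts ab.
subst b; have WF : W *m herm_diag (F a) = herm_diag (F a) *m W.
  apply/matrixP => i j; rewrite /= mul_mx_diag mul_diag_mx !mxE mulrC.
  have [->|Wij] := eqVneq (W i j) 0; first by rewrite !mulr0.
  by rewrite (Fa _ _ (Wab _ _ Wij)).
apply: val_inj => /=.
have := congr1 (fun M : 'M[R[i]]_d => V *m M *m U^t*) WF.
rewrite /= WE0 !mulmxA (unitarymxP Vu) mul1mx -!mulmxA (unitarymxP Uu).
by rewrite mulmx1 !mulmxA => ->.
Qed.

End SpectralLift.

(* Main.v *)
(* Write G for the extension of F. A unitary matrix has a generalized diagonal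
   of entries of modulus at least 1/d!; applied to U^* V, where V diagonalizes
   A + E, this pairs the eigenvalues of A + E with those of A up to O(|E|)
   without any ordering. So A + E = V diag(b) V^* with b = a + O(|E|), and the
   lift of F at A + E is V diag(G b) V^*. The entries of W = U^* V between
   distinct eigenvalues of A are O(|E|), hence products of two of them are
   negligible, and the entries of W diag(G b) W^* can be compared with those of
   W diag(b) W^* = diag(a) + U^* E U after expanding G to first order at a.
   Inside an eigenspace this uses that the Jacobian of G at a commutes with the
   permutations fixing a. *)
Require Import Defs.
From HB Require Import structures.
From mathcomp Require Import all_boot all_order all_algebra fingroup perm.
From mathcomp Require Import all_classical all_reals all_analysis.
From mathcomp Require Import complex ring.

Set Implicit Arguments.
Unset Strict Implicit.
Unset Printing Implicit Defensive.

Import Order.TTheory GRing.Theory Num.Theory.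
Import numFieldNormedType.Exports.

Local Open Scope ring_scope.
Local Open Scope classical_set_scope.
Local Open Scope sesquilinear_scope.

(** * Entrywise control of the maximum norm of a matrix *)

Section Norms.
Context {K : numFieldType} {m n : nat}.
Implicit Type A : 'M[K]_(m, n).

Lemma entry_le_norm A i j : `|A i j| <= `|A|.
Proof.
rewrite [leRHS]/Num.norm/= mx_normE.
have -> : `|A i j| = (`|A (i, j).1 (i, j).2|%:nng)%:num by [].
rewrite num_le; exact: (le_bigmax _ (fun ij => `|A ij.1 ij.2|%:nng) (i, j)).
Qed.

Lemma norm_le_sum A : `|A| <= \sum_i \sum_j `|A i j|.
Proof.
have [->|] := eqVneq `|A| 0.
  by apply: sumr_ge0 => i _; apply: sumr_ge0.
move=> /mx_norm_neq0[[i j]] /= Aij.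
rewrite -[leLHS]/(mx_norm A) Aij (bigD1 i)//= (bigD1 j)//=.
by rewrite -addrA lerDl addr_ge0// !sumr_ge0// => k _; exact: sumr_ge0.
Qed.

End Norms.

(** * Calculus of the rates O(t^n) and o(t) along a filter *)

Section Rates.
Context {C : numFieldType} {T : Type} (Fl : set_system T) {FF : Filter Fl}.
Variable t : T -> C.
Hypothesis t_ge0 : forall x, 0 <= t x.
Hypothesis t_to0 : forall e, 0 < e -> \forall x \near Fl, t x <= e.
Implicit Types f g : T -> C.

(* The asymptotic classes O(t^n) and o(t) along the filter [Fl]. *)
Definition Opow n f :=
  exists2 K, 0 <= K & \forall x \near Fl, `|f x| <= K * t x ^+ n.

Definition osmall f := forall e, 0 < e -> \forall x \near Fl, `|f x| <= e * t x.

Lemma eq_Opow n f g : f =1 g -> Opow n g -> Opow n f.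
Proof. by move=> /funext ->. Qed.

Lemma eq_osmall f g : f =1 g -> osmall g -> osmall f.
Proof. by move=> /funext ->. Qed.

Lemma Opow_cst c : Opow 0 (fun=> c).
Proof.
by exists `|c| => //; apply: nearW => x; rewrite expr0 mulr1.
Qed.

Lemma Opow0 n : Opow n (fun=> 0).
Proof. by exists 0 => //; apply: nearW => x; rewrite normr0 mul0r. Qed.

Lemma OpowD n f g : Opow n f -> Opow n g -> Opow n (fun x => f x + g x).
Proof.
move=> [K K0 fK] [L L0 gL]; exists (K + L); first exact: addr_ge0.
apply: filterS2 fK gL => x fx gx; rewrite mulrDl.
by rewrite (le_trans (ler_normD _ _))// lerD.
Qed.

Lemma OpowM n m f g :
  Opow n f -> Opow m g -> Opow (n + m) (fun x => f x * g x).
Proof.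
move=> [K K0 fK] [L L0 gL]; exists (K * L); first exact: mulr_ge0.
apply: filterS2 fK gL => x fx gx; rewrite exprD mulrACA normrM.
exact: ler_pM.
Qed.

Lemma OpowZ n c f : Opow n f -> Opow n (fun x => c * f x).
Proof. by move=> fn; exact: (OpowM (Opow_cst c) fn). Qed.

Lemma OpowB n f g : Opow n f -> Opow n g -> Opow n (fun x => f x - g x).
Proof.
move=> fn /(OpowZ (-1)) gn; apply: eq_Opow => [x|]; first by rewrite -mulN1r.
exact: OpowD.
Qed.

Lemma Opow_sum n (I : Type) (r : seq I) (P : pred I) (f : I -> T -> C) :
  (forall i, P i -> Opow n (f i)) ->
  Opow n (fun x => \sum_(i <- r | P i) f i x).
Proof.
move=> fn; elim: r => [|i r IH].
  apply: eq_Opow => [x|]; first exact: big_nil.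
  exact: Opow0.
have [Pi|Pi] := boolP (P i).
  apply: eq_Opow => [x|]; first by rewrite big_cons Pi.
  by apply: OpowD => //; exact: fn.
by apply: eq_Opow IH => x; rewrite big_cons (negbTE Pi).
Qed.

Lemma Opow_le n m f : (m <= n)%N -> Opow n f -> Opow m f.
Proof.
move=> mn [K K0 fK]; exists K => //.
apply: filterS2 fK (t_to0 ltr01) => x fx t1.
apply: le_trans fx _; apply: ler_wpM2l => //.
by rewrite ler_wiXn2l.
Qed.

Lemma osmallD f g : osmall f -> osmall g -> osmall (fun x => f x + g x).
Proof.
move=> fo go e e0; have e20 : 0 < e / 2 by rewrite divr_gt0.
apply: filterS2 (fo _ e20) (go _ e20) => x fx gx.
by rewrite [e]splitr mulrDl (le_trans (ler_normD _ _))// lerD.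
Qed.

Lemma osmall_sum (I : Type) (r : seq I) (P : pred I) (f : I -> T -> C) :
  (forall i, P i -> osmall (f i)) ->
  osmall (fun x => \sum_(i <- r | P i) f i x).
Proof.
move=> fo; elim: r => [|i r IH].
  apply: eq_osmall => [x|]; first exact: big_nil.
  by move=> e e0; apply: nearW => x; rewrite normr0 mulr_ge0// ltW.
have [Pi|Pi] := boolP (P i).
  apply: eq_osmall => [x|]; first by rewrite big_cons Pi.
  by apply: osmallD => //; exact: fo.
by apply: eq_osmall IH => x; rewrite big_cons (negbTE Pi).
Qed.

Lemma osmallM f g : Opow 0 f -> osmall g -> osmall (fun x => f x * g x).
Proof.
move=> [K K0 fK] go e e0.
(* [K] may be 0, so the tolerance for [g] is obtained by dividing by [K + 1]. *)
have K1 : 0 < K + 1 by rewrite ltr_wpDl.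
apply: filterS2 fK (go _ (divr_gt0 e0 K1)) => x; rewrite expr0 mulr1 => fx gx.
rewrite normrM (le_trans (ler_pM _ _ fx gx))// mulrA; apply: ler_wpM2r => //.
by rewrite mulrCA ger_pMr// ler_pdivrMr// mul1r lerDl.
Qed.

Lemma osmall_Opow2 f : Opow 2 f -> osmall f.
Proof.
move=> [K K0 fK] e e0; have K1 : 0 < K + 1 by rewrite ltr_wpDl.
apply: filterS2 fK (t_to0 (divr_gt0 e0 K1)) => x fx tx.
apply: (le_trans fx); rewrite expr2 mulrA; apply: ler_wpM2r => //.
rewrite (le_trans (ler_wpM2l K0 tx))//.
by rewrite mulrCA ger_pMr// ler_pdivrMr// mul1r lerDl.
Qed.

Lemma osmall_Opow1 f : osmall f -> Opow 1 f.
Proof. by move=> /(_ 1 ltr01) fo; exists 1. Qed.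

Lemma Opow_dom n f g :
  (forall x, `|f x| <= `|g x|) -> Opow n g -> Opow n f.
Proof.
move=> fg [K K0 gK]; exists K => //; apply: filterS gK => x.
exact: le_trans.
Qed.

Lemma osmall_dom f g :
  (forall x, `|f x| <= `|g x|) -> osmall g -> osmall f.
Proof.
move=> fg go e e0; apply: filterS (go e e0) => x.
exact: le_trans.
Qed.

Lemma Opow_norm_mx n m p (M : T -> 'M[C]_(m, p)) :
  (forall i j, Opow n (fun x => M x i j)) ->
  Opow n (fun x => `|M x|).
Proof.
move=> Mn; apply: (@Opow_dom _ _ (fun x => \sum_i \sum_j `|M x i j|)) => [x|].
  rewrite normr_id ger0_norm ?norm_le_sum//.
  by apply: sumr_ge0 => i _; exact: sumr_ge0.
apply: Opow_sum => i _; apply: Opow_sum => j _.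
by apply: Opow_dom (Mn i j) => x; rewrite normr_id.
Qed.

Lemma osmall_norm_mx m p (M : T -> 'M[C]_(m, p)) :
  (forall i j, osmall (fun x => M x i j)) ->
  osmall (fun x => `|M x|).
Proof.
move=> Mn; apply: (@osmall_dom _ (fun x => \sum_i \sum_j `|M x i j|)) => [x|].
  rewrite normr_id ger0_norm ?norm_le_sum//.
  by apply: sumr_ge0 => i _; exact: sumr_ge0.
apply: osmall_sum => i _; apply: osmall_sum => j _.
by apply: osmall_dom (Mn i j) => x; rewrite normr_id.
Qed.

Lemma Opow_conj_mx n m p q r (U : 'M[C]_(q, m)) (V : 'M[C]_(p, r))
    (M : T -> 'M[C]_(m, p)) :
  (forall i j, Opow n (fun x => M x i j)) ->
  forall i j, Opow n (fun x => (U *m M x *m V) i j).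
Proof.
move=> Mn i j; apply: (eq_Opow (g := fun x =>
    \sum_k V k j * \sum_l U i l * M x l k)) => [x|].
  by rewrite mxE; apply: eq_bigr => k _; rewrite mxE mulrC.
apply: Opow_sum => k _; apply: OpowZ; apply: Opow_sum => l _; apply: OpowZ.
exact: Mn.
Qed.

Lemma osmall_conj_mx m p q r (U : 'M[C]_(q, m)) (V : 'M[C]_(p, r))
    (M : T -> 'M[C]_(m, p)) :
  (forall i j, osmall (fun x => M x i j)) ->
  forall i j, osmall (fun x => (U *m M x *m V) i j).
Proof.
move=> Mn i j; apply: (eq_osmall (g := fun x =>
    \sum_k V k j * \sum_l U i l * M x l k)) => [x|].
  by rewrite mxE; apply: eq_bigr => k _; rewrite mxE mulrC.
apply: osmall_sum => k _; apply: osmallM; first exact: Opow_cst.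
apply: osmall_sum => l _; apply: osmallM; first exact: Opow_cst.
exact: Mn.
Qed.

End Rates.

(** * Entries of unitary matrices *)

Lemma unitary_entry_le1 (C : numClosedFieldType) (d : nat) (W : 'M[C]_d) i j :
  W \is unitarymx -> `|W i j| <= 1.
Proof.
move=> /unitarymxP/matrixP/(_ i i); rewrite !mxE eqxx mulr1n => W1.
rewrite -(@expr_le1 _ 2)// normCK -W1 (bigD1 j)//= !mxE lerDl.
by apply: sumr_ge0 => k _; rewrite !mxE mul_conjC_ge0.
Qed.

(** The Leibniz sum for [\det W], which has modulus 1, consists of d! terms, so one of them has
    modulus at least 1/d!. All entries have modulus at most 1, hence each factor of that term is at
    least as large as the term. *)
Lemma unitary_perm_ge (C : numClosedFieldType) (d : nat) (W : 'M[C]_d) :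
  W \is unitarymx -> exists s : 'S_d, forall i, (d`!)%:R^-1 <= `|W i (s i)|.
Proof.
move=> Wu; have W1 i j : `|W i j| <= 1 by exact: unitary_entry_le1.
have d0 : 0 < (d`!)%:R^-1 :> C by rewrite invr_gt0 ltr0n fact_gt0.
have detW : `|\det W| = 1.
  have := congr1 determinant (unitarymxP Wu).
  rewrite det_mulmx det1 det_map_mx det_tr -normCK => /eqP.
  by rewrite sqrp_eq1// => /eqP.
apply: contrapT => noS.
have small (s : 'S_d) : \prod_i `|W i (s i)| < (d`!)%:R^-1.
  rewrite real_ltNge; [|exact/ger0_real/prodr_ge0|exact/ger0_real/ltW].
  apply/negP => sP; apply: noS; exists s => i; apply: le_trans sP _.
  rewrite (bigD1 i)//= ler_piMr//.
  by apply: prodr_ile1 => k _; rewrite normr_ge0 W1.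
suff : `|\det W| < 1 by rewrite detW ltxx.
apply: (@le_lt_trans _ _ (\sum_(s : 'S_d) \prod_i `|W i (s i)|)).
  apply: (le_trans (ler_norm_sum _ _ _)); apply: ler_sum => s _.
  by rewrite normrM normrX normrN1 expr1n mul1r normr_prod.
apply: (@lt_le_trans _ _ (\sum_(s : 'S_d) (d`!)%:R^-1)).
  apply: ltr_sum => [|s _]; last exact: small.
  by apply/hasP; exists 1%g; rewrite ?mem_index_enum.
by rewrite sumr_const card_Sn -[_^-1 *+ _]mulr_natr mulVf// gt_eqF// -invr_gt0.
Qed.

(** * First-order expansion of a unitarily conjugated diagonal matrix *)

Section Perturbation.
Context {C : numClosedFieldType} {T : Type}.
Context (Fl : set_system T) {FF : Filter Fl}.
Variable t : T -> C.
Hypothesis t_ge0 : forall x, 0 <= t x.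
Hypothesis t_to0 : forall e, 0 < e -> \forall x \near Fl, t x <= e.
Context {d : nat}.
(** [al] and [ga] stand for the eigenvalues of A and the field there, [J] for the Jacobian of the
    extended field. [b] and [g] are the perturbed counterparts of [al] and [ga], [E] is the
    perturbation written in the eigenbasis of A, and [W] is the overlap of that basis with the
    perturbed one. *)
Variables (W E : T -> 'M[C]_d) (b g : T -> 'rV[C]_d) (al ga : 'rV[C]_d).
Variable J : 'M[C]_d.
Local Notation Opow := (Opow Fl t).
Local Notation osmall := (osmall Fl t).

Hypothesis W_unitary : forall x, W x \is unitarymx.
Hypothesis WE :
  forall x, W x *m diag_mx (b x) *m (W x)^t* = diag_mx al + E x.
Hypothesis E1 : forall i j, Opow 1 (fun x => E x i j).
Hypothesis b1 : forall k, Opow 1 (fun x => b x 0 k - al 0 k).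
Hypothesis g1 : forall k, osmall (fun x =>
  g x 0 k - ga 0 k - \sum_l J k l * (b x 0 l - al 0 l)).
Hypothesis ga_block : forall k l, al 0 k = al 0 l -> ga 0 k = ga 0 l.
Hypothesis J_block : forall s : 'S_d, (forall k, al 0 (s k) = al 0 k) ->
  forall k l, J (s k) (s l) = J k l.

(** Entry (m, n) of the rank-one projector onto column k of [W x]; conjugated diagonal matrices are
    weighted sums of these. *)
Let P m n k x := W x m k * (W x n k)^*.

Let mulP (h : T -> 'rV[C]_d) x m n :
  (W x *m diag_mx (h x) *m (W x)^t*) m n = \sum_k P m n k x * h x 0 k.
Proof.
by rewrite mul_mx_diag !mxE; apply: eq_bigr => k _; rewrite !mxE mulrAC.
Qed.

Let sumP m n x : \sum_k P m n k x = (m == n)%:R.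
Proof.
have /unitarymxP/matrixP/(_ m n) := W_unitary x; rewrite !mxE => <-.
by apply: eq_bigr => k _; rewrite !mxE.
Qed.

Let sumP_col k x : \sum_l P l l k x = 1.
Proof.
have := W_unitary x; rewrite -trmxC_unitary => /unitarymxP/matrixP/(_ k k).
rewrite !mxE eqxx mulr1n => <-; apply: eq_bigr => l _.
by rewrite !mxE conjCK mulrC.
Qed.

Let sumPb m n x : \sum_k P m n k x * b x 0 k = al 0 m *+ (m == n) + E x m n.
Proof. by rewrite -mulP WE !mxE. Qed.

Let sumPc m n x c : \sum_k P m n k x * c = c *+ (m == n).
Proof. by rewrite -mulr_suml sumP mulr_natl. Qed.

Let O_W i j : Opow 0 (fun x => W x i j).
Proof.
exists 1 => //; apply: nearW => x; rewrite expr0 mulr1.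
exact: unitary_entry_le1.
Qed.

Let O_Wc i j n : Opow n (fun x => W x i j) -> Opow n (fun x => (W x i j)^*).
Proof.
by move=> [K K0 H]; exists K => //; apply: filterS H => x; rewrite norm_conjC.
Qed.

(** Compare the (i, j) entries of W diag(b) = (diag(al) + E) W. The fixed nonzero gap
    [al 0 j - al 0 i] can be divided out, and what remains contains a factor E or b - al. *)
Let W_off i j : al 0 i != al 0 j -> Opow 1 (fun x => W x i j).
Proof.
move=> ij.
have ji0 : al 0 j - al 0 i != 0 by rewrite subr_eq0 eq_sym.
have eW x : W x i j = (al 0 j - al 0 i)^-1 *
    (\sum_k E x i k * W x k j - W x i j * (b x 0 j - al 0 j)).
  have := congr1 (fun M => (M *m W x) i j) (WE x).
  rewrite -mulmxA -invmx_unitary// mulVmx ?unitarymx_unit// mulmx1.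
  rewrite mulmxDl mul_diag_mx mul_mx_diag !mxE => WbE.
  apply: (mulfI ji0); rewrite mulVKf//.
  by rewrite mulrBr WbE; ring.
apply: (eq_Opow eW).
apply: OpowZ; apply: OpowB.
  by apply: Opow_sum => k _; apply: (@OpowM _ _ _ _ _ 1 0).
exact: (@OpowM _ _ _ _ _ 0 1).
Qed.

Let O_P m n k : Opow 0 (P m n k).
Proof. by apply: (@OpowM _ _ _ _ _ 0 0) => //; exact: O_Wc. Qed.

Let P_off2 m n k : al 0 m != al 0 k -> al 0 n != al 0 k -> Opow 2 (P m n k).
Proof.
move=> mk nk; apply: (@OpowM _ _ _ _ _ 1 1); first exact: W_off.
exact/O_Wc/W_off.
Qed.

Let P_off1 m n k : (al 0 m != al 0 k) || (al 0 n != al 0 k) ->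
  Opow 1 (P m n k).
Proof.
case/orP => k0;
  [apply: (@OpowM _ _ _ _ _ 1 0)|apply: (@OpowM _ _ _ _ _ 0 1)] => //.
- exact: W_off.
- exact: O_Wc.
- exact/O_Wc/W_off.
Qed.

Let O_g1 k : Opow 1 (fun x => g x 0 k - ga 0 k).
Proof.
have sum1 : Opow 1 (fun x => \sum_l J k l * (b x 0 l - al 0 l)).
  by apply: Opow_sum => l _; exact: OpowZ.
apply: eq_Opow => [x|].
  by rewrite -[LHS](subrK (\sum_l J k l * (b x 0 l - al 0 l))).
by apply: OpowD => //; exact: osmall_Opow1.
Qed.

Let O_g k n : Opow 0 (fun x => g x 0 k - ga 0 n).
Proof.
apply: (eq_Opow
  (g := fun x => (g x 0 k - ga 0 k) + (ga 0 k - ga 0 n))) => [x|].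
  by ring.
apply: OpowD; last exact: Opow_cst.
exact: (Opow_le t_ge0 t_to0 (n := 1)).
Qed.

Let O_b k n : Opow 0 (fun x => b x 0 k - al 0 n).
Proof.
apply: (eq_Opow
  (g := fun x => (b x 0 k - al 0 k) + (al 0 k - al 0 n))) => [x|].
  by ring.
apply: OpowD; last exact: Opow_cst.
exact: (Opow_le t_ge0 t_to0 (n := 1)).
Qed.

(** Since m and n differ, constants may be subtracted from g and b for free, which leaves the
    deviation of g from the affine function of slope [q] through (al n, ga n) and (al m, ga m). On
    the blocks of m and n this deviation is O(t) and so is P; on any other block P is already
    O(t^2). *)
Let offblock m n : al 0 m != al 0 n -> osmall (fun x =>
  (W x *m diag_mx (g x) *m (W x)^t*) m n -
  (ga 0 m - ga 0 n) / (al 0 m - al 0 n) * E x m n).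
Proof.
move=> mn; set q := _ / _.
have mnF : (m == n) = false by apply/negbTE; apply: contraNneq mn => ->.
have qE : q * (al 0 m - al 0 n) = ga 0 m - ga 0 n.
  by rewrite /q divfK// subr_eq0.
have eqf x : (W x *m diag_mx (g x) *m (W x)^t*) m n - q * E x m n =
    \sum_k P m n k x * (g x 0 k - ga 0 n - q * (b x 0 k - al 0 n)).
  have EE : E x m n = \sum_k P m n k x * (b x 0 k - al 0 n).
    under eq_bigr do rewrite mulrBr.
    by rewrite sumrB sumPb sumPc mnF subr0 add0r.
  under eq_bigr do rewrite mulrBr mulrBr mulrCA.
  rewrite !sumrB -mulr_sumr -EE -mulP sumPc.
  by rewrite mnF mulr0n subr0.
apply: (eq_osmall eqf); apply: osmall_Opow2 => //; apply: Opow_sum => k _.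
have H1 l : al 0 k = al 0 l ->
    Opow 1 (fun x => g x 0 k - ga 0 l - q * (b x 0 k - al 0 l)).
  by move=> kl; rewrite -kl -(ga_block kl); apply: OpowB => //; exact: OpowZ.
have [kn|kn] := eqVneq (al 0 k) (al 0 n).
  by apply: (@OpowM _ _ _ _ _ 1 1); [apply: P_off1; rewrite kn mn|exact: H1].
have [km|km] := eqVneq (al 0 k) (al 0 m).
  apply: (@OpowM _ _ _ _ _ 1 1).
    by apply: P_off1; rewrite km orbC eq_sym mn.
  (* The affine function of slope [q] may equally be based at m, by [qE]. *)
  apply: eq_Opow (H1 _ km) => x; apply/eqP; rewrite -subr_eq0; apply/eqP.
  by rewrite [LHS](_ : _ = ga 0 m - ga 0 n - q * (al 0 m - al 0 n));
    [rewrite qE subrr | ring].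
apply: (@OpowM _ _ _ _ _ 2 0); first by apply: P_off2; rewrite eq_sym.
by apply: OpowB => //; exact: OpowZ.
Qed.

(* Summed over a whole eigenspace, eigenvalue shifts agree with diagonal entries
   of E up to second order, although individually they need not. *)
Let trace_block (c : 'I_d -> C) :
  (forall k l, al 0 k = al 0 l -> c k = c l) ->
  Opow 2 (fun x => \sum_l c l * (b x 0 l - al 0 l) - \sum_l c l * E x l l).
Proof.
move=> c_block.
(* Both sums are spread over the weights [P l l k]: the first because these sum to 1 over l, the
   second through [sumPb]. Terms with l and k in one block cancel, and for the others the weight is
   O(t^2). *)
have eqf x : \sum_l c l * (b x 0 l - al 0 l) - \sum_l c l * E x l l =
    \sum_l \sum_k P l l k x *
      (c k * (b x 0 k - al 0 k) - c l * (b x 0 k - al 0 l)).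
  under [RHS]eq_bigr do under eq_bigr do rewrite mulrBr.
  under [RHS]eq_bigr do rewrite sumrB.
  rewrite sumrB; congr (_ - _).
    rewrite exchange_big; apply: eq_bigr => k _.
    by rewrite -mulr_suml sumP_col mul1r.
  apply: eq_bigr => l _; under [RHS]eq_bigr do rewrite mulrCA mulrBr.
  by rewrite -mulr_sumr sumrB sumPb sumPc eqxx !mulr1n addrC addKr.
apply: (eq_Opow eqf); apply: Opow_sum => l _; apply: Opow_sum => k _.
have [lk|lk] := eqVneq (al 0 l) (al 0 k).
  apply: eq_Opow => [x|]; first by rewrite lk (c_block _ _ lk) subrr mulr0.
  exact: Opow0.
apply: (@OpowM _ _ _ _ _ 2 0); first exact: P_off2.
apply: OpowB; apply: OpowZ; last exact: O_b.
exact: (Opow_le t_ge0 t_to0 (n := 1)).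
Qed.

(* By symmetry, row and column m of J are constant on the rest of the block. *)
Let kappa m : exists kap, forall k, k != m -> al 0 k = al 0 m ->
  J m m - J m k = kap /\ J m m - J k m = kap.
Proof.
have J_tperm k l : al 0 k = al 0 l ->
    forall i j, J (tperm k l i) (tperm k l j) = J i j.
  by move=> kl; apply: J_block => i; case: tpermP => // ->.
have [[k0 [k0m ak0]]|none] :=
  pselect (exists k0, k0 != m /\ al 0 k0 = al 0 m); last first.
  by exists 0 => k km akm; exfalso; apply: none; exists k.
exists (J m m - J m k0) => k km akm; have J1 : J m k = J m k0.
  rewrite -(J_tperm k k0) ?akm ?ak0// tpermL tpermD//.
by rewrite -(J_tperm k m akm k m) tpermL tpermR J1.
Qed.

(** For k in the block of m, row k of J acts on the shifts b - al as [kap] times the k-th shift plus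
    a functional [c] that does not depend on k. The first part reproduces [kap * E x m n]; the
    second is a multiple of the identity, evaluated by [trace_block]. Other blocks contribute
    O(t^2). *)
Let inblock m n : al 0 m = al 0 n -> osmall (fun x =>
  (W x *m diag_mx (g x) *m (W x)^t*) m n - (ga 0 m *+ (m == n) +
   ((if m == n then J m m else J m m - J n m) * E x m n +
    (\sum_(l | l != m) J m l * E x l l) *+ (m == n)))).
Proof.
move=> mn; have [kap kapE] := kappa m.
(* Row m of J with [kap] taken off its diagonal entry: this correction makes it constant on every
   block, including that of m. *)
pose c l := J m l - kap *+ (l == m).
have c_block k l : al 0 k = al 0 l -> c k = c l.
  move=> kl; rewrite /c; have [akm|akm] := eqVneq (al 0 k) (al 0 m); last first.
    have km : k != m by apply: contraNneq akm => ->.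
    have lm : l != m by apply: contraNneq akm => <-; rewrite kl.
    rewrite (negbTE km) (negbTE lm) -(J_block (s := tperm k l)).
      by rewrite tpermL tpermD.
    by move=> i; case: tpermP => // ->.
  have H i : al 0 i = al 0 m -> J m i - kap *+ (i == m) = J m m - kap.
    move=> aim; have [->//|im] := eqVneq i m.
    by have [<- _] := kapE _ im aim; rewrite subr0 opprB addrC subrK.
  by rewrite (H k)// (H l)// -kl.
pose del x k := b x 0 k - al 0 k.
have eqf x : (W x *m diag_mx (g x) *m (W x)^t*) m n - (ga 0 m *+ (m == n) +
   ((if m == n then J m m else J m m - J n m) * E x m n +
    (\sum_(l | l != m) J m l * E x l l) *+ (m == n))) =
  \sum_k P m n k x * (g x 0 k - ga 0 m - kap * (b x 0 k - al 0 m)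
                      - \sum_l c l * del x l)
  + (m == n)%:R * (\sum_l c l * del x l - \sum_l c l * E x l l).
  have EE : \sum_k P m n k x * (b x 0 k - al 0 m) = E x m n.
    under eq_bigr do rewrite mulrBr.
    by rewrite sumrB sumPb sumPc addrC addKr.
  have -> : \sum_k P m n k x * (g x 0 k - ga 0 m - kap * (b x 0 k - al 0 m)
        - \sum_l c l * del x l) = (W x *m diag_mx (g x) *m (W x)^t*) m n
    - ga 0 m *+ (m == n) - kap * E x m n - (\sum_l c l * del x l) *+ (m == n).
    under eq_bigr do rewrite 3!mulrBr mulrCA.
    by rewrite !sumrB -mulr_sumr EE !sumPc -mulP.
  (* Off the diagonal, [kap] is itself the coefficient of [E x m n]; on the diagonal, [kap] and
     [c m] add up to [J m m]. *)
  have [mnE|mnN] := eqVneq m n; last first.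
    have [_ ->] : J m m - J m n = kap /\ J m m - J n m = kap.
      by apply: kapE; rewrite // eq_sym.
    by rewrite !mulr0n mul0r; ring.
  subst n; have -> : \sum_l c l * E x l l =
      \sum_(l | l != m) J m l * E x l l + (J m m - kap) * E x m m.
    rewrite (bigD1 m)//= addrC /c eqxx mulr1n; congr (_ + _).
    by apply: eq_bigr => l /negbTE->; rewrite subr0.
  by rewrite !mulr1n; ring.
apply: (eq_osmall eqf); apply: osmallD; last first.
  apply: osmall_Opow2 => //; apply: OpowZ; exact: trace_block.
apply: osmall_sum => // k _.
have c_del1 : Opow 1 (fun x => \sum_l c l * del x l).
  by apply: Opow_sum => l _; apply: OpowZ; exact: b1.
have [akm|akm] := eqVneq (al 0 k) (al 0 m); last first.
  apply: osmall_Opow2 => //; apply: (@OpowM _ _ _ _ _ 2 0).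
    by apply: P_off2; rewrite eq_sym// -mn.
  apply: OpowB; last exact: (Opow_le t_ge0 t_to0 (n := 1)).
  apply: OpowB; [exact: O_g|apply: OpowZ; exact: O_b].
apply: osmallM => //; apply: eq_osmall (g1 k) => x.
have cE : \sum_l c l * del x l = \sum_l J m l * del x l - kap * del x m.
  rewrite (bigD1 m)//= [in RHS](bigD1 m)//= /c eqxx mulr1n mulrBl.
  rewrite addrAC; congr (_ + _ - _).
  by apply: eq_bigr => l /negbTE->; rewrite subr0.
have sumJ : \sum_l J k l * del x l =
    \sum_l J m l * del x l + kap * (del x k - del x m).
  have [->|km] := eqVneq k m; first by rewrite subrr mulr0 addr0.
  have [<- _] := kapE _ km akm.
  (* The transposition of k and m preserves [al] and carries row k of J to row m. *)
  have Jk l : J k (tperm k m l) = J m l.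
    rewrite -{1}(tpermR k m); apply: J_block => i.
    by case: tpermP => // ->.
  rewrite (reindex_inj (@perm_inj _ (tperm k m)))/=.
  under eq_bigr do rewrite Jk.
  rewrite (bigD1 m)//= (bigD1 k)//= [in RHS](bigD1 m)//= [in RHS](bigD1 k)//=.
  rewrite tpermL tpermR (eq_bigr (fun l => J m l * del x l)).
    by ring.
  by move=> l /andP[lm lk]; rewrite tpermD// eq_sym.
by rewrite -/(del x) sumJ cE (ga_block akm) /del akm; ring.
Qed.

Lemma unitary_conj_expansion m n : osmall (fun x =>
  (W x *m diag_mx (g x) *m (W x)^t*) m n - (ga 0 m *+ (m == n) +
   ((if al 0 m != al 0 n then (ga 0 m - ga 0 n) / (al 0 m - al 0 n)
     else if m != n then J m m - J n m else J m m) * E x m n +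
    (\sum_(l | l != m) J m l * E x l l) *+ (m == n)))).
Proof.
have [mn|mn] := eqVneq (al 0 m) (al 0 n); last first.
  have mnF : (m == n) = false by apply/negbTE; apply: contraNneq mn => ->.
  by apply: eq_osmall (offblock mn) => x; rewrite mnF !mulr0n add0r addr0.
by apply: eq_osmall (inblock mn) => x; case: (m == n).
Qed.

End Perturbation.

Lemma norm_real_complex (R : realType) (x : R) : `|x%:C%C| = `|x|%:C%C.
Proof. by rewrite normc_def/= expr0n addr0 sqrtr_sqr. Qed.

(** * Unsorted eigenvalues: equivariance of the extension, and alignment *)

Section Extension.
Context {R : realType} {d : nat}.
Implicit Types (F : 'rV[R]_d -> 'rV[R]_d) (x a : 'rV[R]_d) (s : 'S_d).

Lemma extE F s x : ext_defined F x -> sorts s x -> ext F x = ext_by F s x.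
Proof.
move=> Fx sx; apply: Fx => //.
exact: (@xgetPex _ 1%g [set s | sorts s x]) (sorts_exists x).
Qed.

Lemma col_perm_comp (K : Type) (m : nat) (A : 'M[K]_(m, d)) s u :
  col_perm u (col_perm s A) = col_perm (u * s) A.
Proof. by apply/matrixP => i j; rewrite !mxE permM. Qed.

(** If u sorts [col_perm s x], then u * s sorts x, and the value of the extension at x does not
    depend on which sorting permutation is used. *)
Lemma ext_perm F s x : ext_defined F x ->
  ext F (col_perm s x) = col_perm s (ext F x).
Proof.
move=> Fx; rewrite {1}/ext.
have := @xgetPex _ 1%g [set u | sorts u (col_perm s x)] (sorts_exists _).
move: (xget _ _) => u /=; rewrite /sorts col_perm_comp => su.
rewrite (extE Fx su) /ext_by !col_perm_comp.
by rewrite invMg mulgA mulgV mul1g.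
Qed.

Lemma herm_conj_perm (U : 'M[R[i]]_d) x s :
  herm_conj (col_perm s U) (herm_diag (col_perm s x)) =
  herm_conj U (herm_diag x).
Proof.
apply: val_inj; apply/matrixP => i j; rewrite /= !mul_mx_diag !mxE.
rewrite [RHS](reindex_inj (@perm_inj _ s)); apply: eq_bigr => k _.
by rewrite !mxE.
Qed.

Lemma unitary_col_perm (U : 'M[R[i]]_d) s :
  U \is unitarymx -> col_perm s U \is unitarymx.
Proof.
move=> Uu; rewrite col_permE; apply: mul_unitarymx => //; apply/unitarymxP.
by rewrite tr_perm_mx map_perm_mx -perm_mxM mulgV perm_mx1.
Qed.

(** Frees the lift from the ordering of eigenvalues: permuting x and the columns of V together sorts
    the spectrum without changing the matrix. *)
Lemma spectral_lift_ext F (B : hermmx R d) (V : 'M[R[i]]_d) x :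
  V \is unitarymx -> B = herm_conj V (herm_diag x) -> ext_defined F x ->
  lift_defined F B /\ spectral_lift F B = herm_conj V (herm_diag (ext F x)).
Proof.
move=> Vu BE Fx; have [s sx] := sorts_exists x.
have dB : spectral_decomp B (col_perm s V) (col_perm s x).
  by split; rewrite ?herm_conj_perm//; exact: unitary_col_perm.
have Fs : block_constant F (col_perm s x) by move/ext_definedP: Fx; exact.
split; first by exists (col_perm s V), (col_perm s x).
rewrite (spectral_liftE dB Fs) (extE Fx sx) -[RHS](herm_conj_perm _ _ s).
by rewrite /ext_by col_perm_comp mulgV col_perm1.
Qed.

(** With W = U^* V and E = U^* (B - A) U, the (i, s i) entry of E W = W diag(b) - diag(a) W is the
    eigenvalue difference times [W i (s i)]. Taking s from [unitary_perm_ge] bounds that entry of W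
    below by 1/d!, and s then reorders the decomposition of B. *)
Lemma aligned_decomp (U : 'M[R[i]]_d) a (A B : hermmx R d) :
  U \is unitarymx -> A = herm_conj U (herm_diag a) ->
  exists Vb : 'M[R[i]]_d * 'rV[R]_d,
  [/\ Vb.1 \is unitarymx, B = herm_conj Vb.1 (herm_diag Vb.2) &
     forall i, (`|Vb.2 0 i - a 0 i|)%:C%C <= (d`!)%:R *
       \sum_k `|(U^t* *m (hermval B - A) *m U) i k| ].
Proof.
move=> Uu AE; have [V [b [Vu _ BE]]] := spectral_decomp_exists B.
have Ui : U^t* *m U = 1%:M.
  by rewrite -invmx_unitary ?mulVmx ?unitarymx_unit.
have Vi : V^t* *m V = 1%:M.
  by rewrite -invmx_unitary ?mulVmx ?unitarymx_unit.
pose W := U^t* *m V.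
have Wu : W \is unitarymx by rewrite mul_unitarymx ?trmxC_unitary.
have [s sW] := unitary_perm_ge Wu.
exists (col_perm s V, col_perm s b) => /=; split.
- exact: unitary_col_perm.
- by rewrite herm_conj_perm.
move=> i; set E := U^t* *m _ *m U.
have EW : E *m W = W *m herm_diag b - herm_diag a *m W.
  rewrite /E /W !mulmxA mulmxtVK// mulmxBr mulmxBl BE AE /=.
  rewrite -!mulmxA Vi mulmx1 !mulmxA; congr (_ - _).
  by rewrite Ui mul1mx ?mulmxA.
have := congr1 (fun M : 'M[R[i]]_d => M i (s i)) EW.
rewrite /= mul_mx_diag mul_diag_mx !mxE mulrC -mulrBl -rmorphB /= => EWi.
have sum_le : `|\sum_k E i k * W k (s i)| <= \sum_k `|E i k|.
  apply: (le_trans (ler_norm_sum _ _ _)); apply: ler_sum => k _.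
  by rewrite normrM ler_piMr// unitary_entry_le1.
have f0 : 0 < (d`!)%:R :> (R[i])%C by rewrite ltr0n fact_gt0.
rewrite -ler_pdivrMl//; apply: le_trans sum_le.
rewrite EWi normrM mulrC norm_real_complex.
by have := sW i; rewrite mxE; apply: ler_wpM2l; rewrite ler0c.
Qed.

Lemma continuous_col_perm (s : 'S_d) :
  continuous (col_perm s : 'rV[R]_d -> 'rV[R]_d).
Proof.
pose cs : {linear 'rV[R]_d -> 'rV[R]_d} := col_perm s.
apply: (@bounded_linear_continuous _ _ _ cs).
apply/linear_boundedP; exists d%:R; split; first exact: num_real.
move=> r dr x.
apply: le_trans (norm_le_sum _) _; rewrite big_ord1.
apply: (@le_trans _ _ (\sum_(j < d) `|x|)).
  by apply: ler_sum => j _; rewrite mxE; exact: entry_le_norm.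
rewrite sumr_const card_ord -mulr_natl; apply: ler_wpM2r => //.
exact: ltW.
Qed.

(** Near a fixed point a of s the extension commutes with s; by the chain rule its differential at a
    commutes with s too, and basis vectors turn this into invariance of the entries. *)
Lemma ext_jac_perm F a s :
  differentiable (ext F) a -> (\forall x \near a, ext_defined F x) ->
  col_perm s a = a ->
  forall k l, ext_jac F a (s k) (s l) = ext_jac F a k l.
Proof.
move=> dF defF sa k l.
have [cs csE] : exists cs : {linear 'rV[R]_d -> 'rV[R]_d},
    cs = col_perm s :> (_ -> _).
  by exists (col_perm s).
have cs_cont : continuous cs by rewrite csE; exact: continuous_col_perm.
have dcs x : differentiable cs x by exact: linear_differentiable.
have csa : cs a = a by rewrite csE.
have dFs : differentiable (ext F) (cs a) by rewrite csa.
have dE v : 'd (ext F) a (cs v) = cs ('d (ext F) a v).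
  have e : \near a, (ext F \o cs) a = (cs \o ext F) a.
    by near=> x; rewrite /= csE; apply: ext_perm; near: x.
  have d1 := differentiable_comp (dcs a) dFs.
  have d2 := differentiable_comp dF (dcs (ext F a)).
  have := etrans (esym (deriveE v d1))
    (etrans (near_eq_derive v e) (deriveE v d2)).
  have D1 := f_equal (fun h : 'rV[R]_d -> 'rV[R]_d => h v)
    (diff_comp (dcs a) dFs).
  have D2 := f_equal (fun h : 'rV[R]_d -> 'rV[R]_d => h v)
    (diff_comp dF (dcs (ext F a))).
  move=> D; have := etrans (esym D1) (etrans D D2) => {D D1 D2}.
  rewrite /comp csa => D.
  have L1 := f_equal (fun h : 'rV[R]_d -> 'rV[R]_d => h v) (diff_lin a cs_cont).
  have L2 := f_equal (fun h : 'rV[R]_d -> 'rV[R]_d => h ('d (ext F) a v))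
    (diff_lin (ext F a) cs_cont).
  exact: (etrans (f_equal (fun w => 'd (ext F) a w) (esym L1)) (etrans D L2)).
have := dE (delta_mx 0 (s l)).
have -> : cs (delta_mx 0 (s l)) = delta_mx 0 l.
  by apply/rowP => j; rewrite csE !mxE (inj_eq perm_inj).
by move=> /rowP/(_ k); rewrite csE !mxE => ->.
Unshelve. all: by end_near. Qed.

End Extension.

(** * From entrywise complex rates to differentiability on Hermitian matrices *)

Section HermitianFrechet.
Context {R : realType} {d : nat}.
Local Notation H := (hermmx R d).

(* [herm_norm] seen as a complex number, as the rates above are [C]-valued. *)
Let t (E : H) : R[i] := `|hermval E|.

Lemma norm_hermE (E : H) : (`|E| : R)%:C%C = `|hermval E|.
Proof. exact: herm_normE. Qed.

Lemma norm_herm_to0 (e : R[i]) : 0 < e -> \forall E \near (0 : H), t E <= e.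
Proof.
move=> e0; have eE : e = (complex.Re e)%:C%C by rewrite RRe_real// gtr0_real.
have e0' : 0 < complex.Re e by move: e0; rewrite [X in _ < X]eE ltcR.
apply/nbhs_norm0P; exists (complex.Re e) => //= E.
by move=> /ltW; rewrite -lecR norm_hermE -eE.
Qed.

Lemma herm_linear (f : H -> 'M[R[i]]_d) : (forall E, f E \is hermsymmx) ->
  (forall (k : R) E E', f (k *: E + E') = k%:C%C *: f E + f E') ->
  exists L : {linear H -> H}, forall E, hermval (L E) = f E.
Proof.
move=> fH flin; pose L E := HermMx (fH E).
have Llin : linear L by move=> k E E'; apply: val_inj; rewrite /= flin.
pose LL := GRing.isLinear.Build R H H *:%R L Llin.
pose L' : {linear H -> H} := HB.pack L LL.
by exists L'.
Qed.

(** The O(1) bound makes L bounded near 0, hence continuous, as uniqueness of the differential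
    requires. The entrywise o(t) bounds pass to the norm of the remainder. *)
Lemma herm_differentiable (f : H -> H) (A : H) (L : {linear H -> H}) :
  (forall i j, Opow (nbhs (0 : H)) t 0 (fun E => hermval (L E) i j)) ->
  (forall i j, osmall (nbhs (0 : H)) t
    (fun E => (hermval (f (A + E)) - hermval (f A) - hermval (L E)) i j)) ->
  differentiable f A /\ 'd f A = L :> (H -> H).
Proof.
move=> L0 fo.
have Lc : continuous L.
  apply/linear_bounded_continuous/ex_bound.
  have [K K0 LK] := Opow_norm_mx L0.
  exists (complex.Re K); apply: filterS LK => E.
  rewrite expr0 mulr1 normr_id -norm_hermE -[K]RRe_real ?ger0_real//.
  by rewrite lecR.
have fL : f \o shift A = cst (f A) + L +o_ 0 id.
  apply/eqaddoP => e e0; have eC : 0 < e%:C%C by rewrite ltcR.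
  have t0 (E : H) : 0 <= t E by exact: normr_ge0.
  have small := osmall_norm_mx t0 fo eC.
  near=> E; have : `|(`|hermval (f (A + E)) - hermval (f A) - hermval (L E)|)|
      <= e%:C%C * t E by near: E; exact: small.
  rewrite normr_id /t -[X in `|X|]/(hermval (f (A + E) - f A - L E)).
  rewrite -!norm_hermE -rmorphM/= lecR; congr (_ <= _).
  by rewrite -addrA -opprD (addrC A).
have dE := diff_unique Lc fL.
by split=> //; apply/diff_locallyP; rewrite dE.
Unshelve. all: by end_near. Qed.

End HermitianFrechet.

(** * The candidate derivative: hermiticity and real-linearity *)

Section Lift.
Context {R : realType} {d : nat}.
Implicit Types (F : 'rV[R]_d -> 'rV[R]_d) (a : 'rV[R]_d).

Lemma ext_nonincr F a : ext_defined F a -> nonincr a -> ext F a = F a.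
Proof.
move=> Fa aP; have s1 : sorts 1%g a by rewrite /sorts col_perm1.
by rewrite (extE Fa s1) /ext_by invg1 !col_perm1.
Qed.

(** Makes the Hadamard product with a Hermitian matrix Hermitian. For equal eigenvalues, the
    transposition of m and n fixes a, so it preserves the Jacobian. *)
Lemma divdiff_sym F a : differentiable (ext F) a ->
  (\forall x \near a, ext_defined F x) ->
  forall m n, divdiff F a m n = divdiff F a n m.
Proof.
move=> dF Fnear m n; rewrite [LHS]mxE [RHS]mxE eq_sym.
have [amn|amn] /= := eqVneq (a 0 n) (a 0 m).
  have [->//|nm] := eqVneq n m.
  have sa : col_perm (tperm m n) a = a.
    by apply/rowP => i; rewrite mxE; case: tpermP => // ->.
  have Jp := ext_jac_perm dF Fnear sa.
  by rewrite -(Jp m m) -(Jp n m) tpermL tpermR.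
by rewrite -[in LHS]opprB -[X in _ / X]opprB invrN mulrNN.
Qed.

(** The derivative in the eigenbasis of A, as a formula on all complex matrices; taking real parts
    changes nothing on a Hermitian diagonal. *)
Definition diag_lift_diff F a (E : 'M[R[i]]_d) : 'M[R[i]]_d :=
  let e : 'cV[R]_d := \col_i complex.Re (E i i) in
  hadamard (map_mx (real_complex R) (divdiff F a)) E +
  diag_mx (map_mx (real_complex R) (offdiag (ext_jac F a) *m e)^T).

Definition lift_diff (U : 'M[R[i]]_d) F a (E : 'M[R[i]]_d) : 'M[R[i]]_d :=
  U *m diag_lift_diff F a (U^t* *m E *m U) *m U^t*.

Lemma diag_lift_diffE F a (E : 'M[R[i]]_d) m n :
  diag_lift_diff F a E m n = (divdiff F a m n)%:C%C * E m n +
    (\sum_(l | l != m) ext_jac F a m l * complex.Re (E l l))%:C%C *+ (m == n).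
Proof.
rewrite mxE mxE mxE [X in _ + X]mxE; congr (_ + _).
case: (eqVneq m n) => _; last by rewrite !mulr0n.
rewrite !mulr1n 3!mxE; congr (_%:C)%C; rewrite (bigD1 m)//= !mxE eqxx.
rewrite mulr1 subrr mul0r add0r; apply: eq_bigr => l lm; rewrite !mxE.
by rewrite eq_sym (negbTE lm) mulr0 subr0.
Qed.

Lemma lift_diff_herm U F a (E : hermmx R d) :
  (forall m n, divdiff F a m n = divdiff F a n m) ->
  lift_diff U F a E \is hermsymmx.
Proof.
move=> Dsym.
have EH : U^t* *m hermval E *m U \is hermsymmx.
  by have := hermvalP (herm_conj (U^t*) E); rewrite /= trmxCK.
suff MH : hadamard (map_mx (real_complex R) (divdiff F a))
    (U^t* *m hermval E *m U) \is hermsymmx.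
  rewrite /lift_diff /diag_lift_diff /=; set e := offdiag _ *m _.
  exact: (hermvalP (herm_conj U (HermMx MH + herm_diag e^T))).
have adjE (M : 'M[R[i]]_d) k l : M^t* k l = (M l k)^* by rewrite 2!mxE.
have hadE (D : 'M[R]_d) (M : 'M[R[i]]_d) k l :
    hadamard (map_mx (real_complex R) D) M k l = (D k l)%:C%C * M k l.
  by rewrite 2!mxE.
apply/hermsymP/matrixP => i j; rewrite adjE !hadE Dsym rmorphM/= -adjE.
rewrite (hermsymP _ EH); congr (_ * _).
by apply/CrealP; rewrite complex_real.
Qed.

Lemma diag_lift_diff_linear F a (k : R) (E E' : 'M[R[i]]_d) :
  diag_lift_diff F a (k%:C%C *: E + E') =
  k%:C%C *: diag_lift_diff F a E + diag_lift_diff F a E'.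
Proof.
have ReD l : complex.Re ((k%:C%C *: E + E') l l) =
    k * complex.Re (E l l) + complex.Re (E' l l).
  rewrite !mxE; case: (E l l) (E' l l) => [x y] [x' y'] /=.
  by rewrite mul0r subr0.
have mxD (c : R[i]) (M N : 'M[R[i]]_d) i j :
    (c *: M + N) i j = c * M i j + N i j by rewrite 2!mxE.
apply/matrixP => i j; rewrite mxD !diag_lift_diffE mxD.
under eq_bigr do rewrite ReD mulrDr mulrCA.
rewrite big_split -mulr_sumr /= rmorphD rmorphM /= mulrnDl -mulrnAr.
rewrite mulrDr mulrCA [in RHS]mulrDr.
by rewrite !addrA; congr (_ + _); rewrite addrAC.
Qed.

Lemma lift_diff_linear U F a (k : R) (E E' : 'M[R[i]]_d) :
  lift_diff U F a (k%:C%C *: E + E') =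
  k%:C%C *: lift_diff U F a E + lift_diff U F a E'.
Proof.
have conjD (V W M N : 'M[R[i]]_d) :
    V *m (k%:C%C *: M + N) *m W = k%:C%C *: (V *m M *m W) + V *m N *m W.
  by rewrite mulmxDr mulmxDl -scalemxAr -scalemxAl.
by rewrite /lift_diff conjD diag_lift_diff_linear conjD.
Qed.

End Lift.

Lemma herm_entry_real (R : realType) (d : nat) (M : 'M[R[i]]_d) l :
  M \is hermsymmx -> (complex.Re (M l l))%:C%C = M l l.
Proof.
move=> /hermsymP/matrixP/(_ l l); rewrite mxE mxE => Ml.
by rewrite RRe_real//; apply/CrealP.
Qed.

(** * Substituting an O(E) displacement into a differentiable field *)

Section Alignment.
Context {R : realType} {d : nat}.
Local Notation H := (hermmx R d).
(** Meant for the displacement of the aligned eigenvalues. These come from a choice for each E, so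
    only a rate at 0 is assumed. *)
Variables (h : H -> 'rV[R]_d).
Let t (E : H) : R[i] := `|hermval E|.
Hypothesis h1 : forall k, Opow (nbhs (0 : H)) t 1 (fun E => (h E 0 k)%:C%C).

Lemma Opow1_bound : exists2 K : R, 0 < K & \forall E \near (0 : H),
  `|h E| <= K * `|E|.
Proof.
have : Opow (nbhs (0 : H)) t 1 (fun E => (`|h E|)%:C%C).
  apply: (@Opow_dom _ _ _ _ _ _ _ (fun E => \sum_k `|(h E 0 k)%:C%C|)) => [E|].
    rewrite norm_real_complex normr_id [leRHS]ger0_norm ?sumr_ge0//.
    under eq_bigr do rewrite norm_real_complex.
    rewrite -rmorph_sum/= lecR.
    by apply: le_trans (norm_le_sum _) _; rewrite big_ord1.
  apply: Opow_sum => k _.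
  by apply: Opow_dom (h1 k) => E; rewrite normr_id.
move=> [K K0 hK].
have KE : K = (complex.Re K)%:C%C by rewrite RRe_real ?ger0_real.
(* Adding 1 makes the constant positive, so that it can be divided by. *)
exists (complex.Re K + 1).
  by rewrite ltr_wpDl//; move: K0; rewrite [X in _ <= X]KE ler0c.
near=> E.
have : `|(`|h E|)%:C%C| <= K * t E ^+ 1 by near: E; exact: hK.
rewrite expr1 norm_real_complex normr_id /t -norm_hermE KE -rmorphM/= lecR.
by move=> /le_trans; apply; rewrite ler_wpM2r// lerDl.
Unshelve. all: by end_near. Qed.

Lemma Opow1_cvg0 : h E @[E --> (0 : H)] --> (0 : 'rV[R]_d).
Proof.
have [K K0 hK] := Opow1_bound.
apply/(@cvgrPdist_le _ _ _ (nbhs (0 : H))) => e e0; near=> E.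
rewrite sub0r normrN.
apply: (@le_trans _ _ (K * `|E|)); first by near: E.
rewrite mulrC -ler_pdivlMr//; near: E.
by apply: (nbhs0_le (divr_gt0 e0 K0)).
Unshelve. all: by end_near. Qed.

(** The remainder of G at a is o(h E), and [h E] is O(E); the tolerance e / K for the former gives e
    for the composite. *)
Lemma diff_osmall (G : 'rV[R]_d -> 'rV[R]_d) a : differentiable G a ->
  forall k, osmall (nbhs (0 : H)) t
   (fun E => (G (a + h E) 0 k - G a 0 k - ('d G a (h E)) 0 k)%:C%C).
Proof.
move=> dG k e e0; have [K K0 hK] := Opow1_bound.
have eE : e = (complex.Re e)%:C%C by rewrite RRe_real// gtr0_real.
have e0' : 0 < complex.Re e by move: e0; rewrite [X in _ < X]eE ltcR.
have /eqaddoP/(_ _ (divr_gt0 e0' K0)) := diff_locally dG.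
move=> /Opow1_cvg0 small; near=> E.
rewrite norm_real_complex /t -norm_hermE eE -rmorphM/= lecR.
have : `|(G \o shift a - (cst (G a) + 'd G a)) (h E)| <=
    complex.Re e / K * `|h E| by near: E; exact: small.
have hE : `|h E| <= K * `|E| by near: E.
move=> GE; apply: (@le_trans _ _ (complex.Re e / K * `|h E|)); last first.
  rewrite -mulrA ler_wpM2l//; first exact: ltW.
  by rewrite ler_pdivrMl.
apply: le_trans GE; rewrite -addrA -opprD addrC.
have := entry_le_norm ((G \o shift a - (cst (G a) + 'd G a)) (h E)) 0 k.
apply: le_trans.
rewrite [X in _ <= `|X|](_ : _ =
   (G (h E + a) - (G a + 'd G a (h E))) 0 k); last by [].
by rewrite !mxE (addrC (h E)) (addrC (- _)).
Unshelve. all: by end_near. Qed.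

End Alignment.

(** * Assembly: the expansion applied to the aligned decompositions of A + E *)

Theorem theorem2p8 (R : realType) (d : nat) (A : hermmx R d)
    (U : 'M[R[i]]_d) (a : 'rV[R]_d) (F : 'rV[R]_d -> 'rV[R]_d) :
  spectral_decomp A U a ->
  C1_point_symmetric F a ->
  [/\ \forall B \near A, lift_defined F B,
      differentiable (spectral_lift F) A
    & forall E : hermmx R d,
        let E' : 'M[R[i]]_d := U^t* *m E *m U in
        let e : 'cV[R]_d := \col_i complex.Re (E' i i) in
        'd (spectral_lift F) A E =
          U *m (hadamard (map_mx (real_complex R) (divdiff F a)) E' +
                diag_mx (map_mx (real_complex R)
                           (offdiag (ext_jac F a) *m e)^T)) *m U^t*
        :> 'M[R[i]]_d].
Proof.
move=> [Uu aP AE] [_ Fnear].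
have Fdef : \forall x \near a, ext_defined F x.
  by apply: filterS Fnear => x [].
have [Fa dF _] := nbhs_singleton Fnear.
have GE := ext_nonincr Fa aP.
have Dsym := divdiff_sym dF Fdef.
have Ui : U^t* *m U = 1%:M.
  by rewrite -invmx_unitary ?mulVmx ?unitarymx_unit.
(* An eigenvector matrix and an aligned, possibly unsorted, vector of eigenvalues are chosen for
   each E, with no regularity in E. *)
have [Vb VbP] := choice (fun E => aligned_decomp (A + E) Uu AE).
pose t (E : hermmx R d) : R[i] := `|hermval E|.
have t0 E : 0 <= t E by exact: normr_ge0.
have t_to0 := @norm_herm_to0 R d.
pose h E := (Vb E).2 - a.
have hE E : (Vb E).2 = a + h E by rewrite /h addrC subrK.
pose Eh E := U^t* *m hermval E *m U.
have Eh1 i j : Opow (nbhs 0) t 1 (fun E => Eh E i j).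
  apply: Opow_conj_mx => k l; exists 1 => //; apply: nearW => E.
  by rewrite mul1r expr1; exact: entry_le_norm.
have h1 k : Opow (nbhs 0) t 1 (fun E => (h E 0 k)%:C%C).
  apply: (@Opow_dom _ _ _ _ _ _ _ (fun E => (d`!)%:R * \sum_j `|Eh E k j|)).
    move=> E; have [_ _ /(_ k)] := VbP E.
    rewrite [hermval (A + E)]/= addrAC subrr add0r => bk.
    rewrite norm_real_complex [leRHS]ger0_norm ?mulr_ge0 ?sumr_ge0//.
    by rewrite /h mxE [X in _ + X]mxE.
  apply: OpowZ; apply: Opow_sum => j _.
  by apply: Opow_dom (Eh1 k j) => E; rewrite normr_id.
(* The aligned eigenvalues tend to a, so they end up where the extension is well defined. *)
have defb : \forall E \near (0 : hermmx R d), ext_defined F ((Vb E).2).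
  have F0 : \forall v \near (0 : 'rV[R]_d), ext_defined F (a + v).
    exact: (proj1 (nbhs0P (ext_defined F) a) Fdef).
  have Fh : \forall E \near (0 : hermmx R d), ext_defined F (a + h E).
    exact: Opow1_cvg0 h1 _ F0.
  by apply: filterS Fh => E; rewrite hE.
have liftb : \forall E \near (0 : hermmx R d), lift_defined F (A + E) /\
    spectral_lift F (A + E) =
      herm_conj (Vb E).1 (herm_diag (ext F (Vb E).2)).
  apply: filterS defb => E Eb; have [Vu BE _] := VbP E.
  exact: spectral_lift_ext.
have lift_near : \forall B \near A, lift_defined F B.
  by apply/nbhs0P; apply: filterS liftb => E [].
have liftA : spectral_lift F A = herm_conj U (herm_diag (F a)).
  by have [_] := spectral_lift_ext Uu AE Fa; rewrite GE.
have [L LE] := herm_linear (fun E => lift_diff_herm U E Dsym)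
  (fun k E E' => lift_diff_linear U F a k E E').
pose rc := map_mx (real_complex R) : 'rV[R]_d -> 'rV[R[i]]_d.
pose W E := U^t* *m (Vb E).1.
have Wu E : W E \is unitarymx.
  by have [Vu _ _] := VbP E; rewrite mul_unitarymx ?trmxC_unitary.
have WE E : W E *m diag_mx (rc (Vb E).2) *m (W E)^t* =
    diag_mx (rc a) + Eh E.
  have [_ /(congr1 (@hermval R d)) /= BE _] := VbP E.
  rewrite /W trmx_mul map_mxM trmxCK !mulmxA -(mulmxA (U^t*)) -(mulmxA (U^t*)).
  rewrite -BE AE mulmxDr mulmxDl /= !mulmxA Ui mul1mx -mulmxA Ui mulmx1.
  by [].
have b1 k : Opow (nbhs 0) t 1 (fun E => rc (Vb E).2 0 k - rc a 0 k).
  by apply: eq_Opow (h1 k) => E; rewrite !mxE -rmorphB.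
have g1 k : osmall (nbhs 0) t (fun E =>
   rc (ext F (Vb E).2) 0 k - rc (F a) 0 k -
   \sum_l map_mx (real_complex R) (ext_jac F a) k l *
     (rc (Vb E).2 0 l - rc a 0 l)).
  apply: eq_osmall (diff_osmall h1 dF k) => E.
  rewrite -hE GE !rmorphB /= !mxE; congr (_ - _).
  (* The differential acts on row vectors by right multiplication by ['J], whose transpose is
     [ext_jac]. *)
  rewrite -(mul_rV_lin1 ('d (ext F) a)) mxE rmorph_sum; apply: eq_bigr => l _.
  by rewrite !mxE rmorphM rmorphB mulrC.
have Fblock k l : rc a 0 k = rc a 0 l -> rc (F a) 0 k = rc (F a) 0 l.
  have := proj1 (ext_definedP F a) Fa 1%g; rewrite /sorts col_perm1.
  by move=> /(_ aP) /(_ k l) bc; rewrite !mxE => /complexI/bc ->.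
have Jblock (s : 'S_d) : (forall k, rc a 0 (s k) = rc a 0 k) ->
    forall k l, map_mx (real_complex R) (ext_jac F a) (s k) (s l) =
                map_mx (real_complex R) (ext_jac F a) k l.
  move=> sa k l; rewrite mxE [RHS]mxE ext_jac_perm//.
  by apply/rowP => j; have := sa j; rewrite !mxE => /complexI.
have EhH E l : (complex.Re (Eh E l l))%:C%C = Eh E l l.
  apply: herm_entry_real.
  by have := hermvalP (herm_conj (U^t*) E); rewrite /= trmxCK.
have TE E m n : diag_lift_diff F a (Eh E) m n =
    (divdiff F a m n)%:C%C * Eh E m n +
    (\sum_(l | l != m) (ext_jac F a m l)%:C%C * Eh E l l) *+ (m == n).
  rewrite diag_lift_diffE rmorph_sum; congr (_ + _ *+ _).
  by apply: eq_bigr => l _; rewrite rmorphM /= EhH.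
(* The remainder of the lift, seen in the eigenbasis of A, is entrywise o(E). *)
have Do m n : osmall (nbhs 0) t (fun E =>
    (W E *m diag_mx (rc (ext F (Vb E).2)) *m (W E)^t* - diag_mx (rc (F a))
     - diag_lift_diff F a (Eh E)) m n).
  apply: eq_osmall (unitary_conj_expansion t0 t_to0 Wu WE Eh1 b1 g1 Fblock
    Jblock m n) => E.
  have mxB (M N P : 'M[R[i]]_d) : (M - N - P) m n = M m n - N m n - P m n.
    by rewrite !mxE.
  rewrite mxB TE -addrA -opprD; congr (_ - (_ + (_ + _))).
  - by rewrite mxE.
  - congr (_ * _); rewrite [divdiff _ _ _ _]mxE !mxE (inj_eq (@complexI R)).
    have [_|_] /= := eqVneq (a 0 m) (a 0 n).
      by case: (m != n); rewrite ?rmorphB.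
    by rewrite fmorph_div !rmorphB.
  - by congr (_ *+ _); apply: eq_bigr => l _; congr (_ * _); rewrite [RHS]mxE.
have L0 i j : Opow (nbhs 0) t 0 (fun E => hermval (L E) i j).
  apply: eq_Opow => [E|]; first by rewrite LE.
  apply: Opow_conj_mx => m n; apply: eq_Opow => [E|]; first exact: (TE E m n).
  apply: (Opow_le t0 t_to0 (n := 1)) => //.
  apply: OpowD; first exact: OpowZ.
  case: (m == n); last by apply: eq_Opow => [E|]; [rewrite mulr0n|exact: Opow0].
  by apply: Opow_sum => l _; apply: OpowZ.
(* Conjugating by U undoes the change of basis, since U W is the eigenvector matrix of A + E. *)
have UD E (x : 'rV[R]_d) : U *m (W E *m diag_mx (rc x) *m (W E)^t* -
      diag_mx (rc (F a)) - diag_lift_diff F a (Eh E)) *m U^t* =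
    hermval (herm_conj (Vb E).1 (herm_diag x)) -
    hermval (herm_conj U (herm_diag (F a))) - lift_diff U F a (hermval E).
  rewrite /lift_diff !mulmxBr !mulmxBl /W trmx_mul map_mxM trmxCK !mulmxA.
  by rewrite (unitarymxP Uu) mul1mx mulmxtVK.
have fo i j : osmall (nbhs 0) t (fun E => (hermval (spectral_lift F (A + E))
    - hermval (spectral_lift F A) - hermval (L E)) i j).
  move=> e e0; have small := osmall_conj_mx t0 U (U^t*) Do i j e0.
  near=> E; have [_ ->] : lift_defined F (A + E) /\ spectral_lift F (A + E) =
      herm_conj (Vb E).1 (herm_diag (ext F (Vb E).2)) by near: E.
  by rewrite liftA LE -UD; near: E; exact: small.
have [dL dE] := herm_differentiable L0 fo.
by split=> // E; rewrite dE LE.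
Unshelve. all: by end_near. Qed.
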